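(* Let $Q$ be a finite graded poset of rank $r$ with $|Q|=d$, and suppose that $d$ is odd. Let $\Omega(Q,k)$ be the order polynomial of $Q$. Then $$\sum_{m=0}^{N}(-1)^{N+m}\binom{d+2}{N-m}\,\Omega(Q,m(r+2)+1)=0,$$ where $N:=\lceil d/2\rceil$.
   Context: $C_k$ denotes the chain with $k$ elements. $\Omega(Q,k)$ is the order polynomial of $Q$: for positive integers $k$ it is the number of order-preserving maps $f:Q\to C_k$ (i.e. $x\le y$ implies $f(x)\le f(y)$). The poset $Q$ is graded of rank $r$ if all maximal chains of $Q$ have the same length $r$, where the length of a chain is its number of elements minus one. *)

(* Defs.v *)
From mathcomp Require Import all_boot all_order all_algebra.

Set Implicit Arguments.
Unset Strict Implicit.
Unset Printing Implicit Defensive.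

Import Order.TTheory GRing.Theory Num.Theory.
Local Open Scope order_scope.

Definition is_chain (disp : Order.disp_t) (Q : finPOrderType disp)
    (A : {set Q}) : bool :=
  [forall x in A, forall y in A, x >=< y].

(* The length of a chain is its number of elements minus one. The condition
   is written #|A| = r.+1, so that the empty poset, whose only maximal chain
   is set0, is not graded of rank 0. *)
Definition graded_of_rank (disp : Order.disp_t) (Q : finPOrderType disp)
    (r : nat) : Prop :=
  forall A : {set Q}, maxset (@is_chain disp Q) A -> #|A| = r.+1.

Definition order_preserving (disp : Order.disp_t) (Q : finPOrderType disp)
    (k : nat) (f : {ffun Q -> 'I_k}) : bool :=
  [forall x, forall y, (x <= y) ==> (f x <= f y)].

(* Value of the order polynomial of Q at the positive integer k; the chain
   C_k is 'I_k with its canonical order. *)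
Definition order_polynomial (disp : Order.disp_t) (Q : finPOrderType disp)
    (k : nat) : nat :=
  #|[set f : {ffun Q -> 'I_k} | order_preserving f]|.

(* Main.v *)
(** Sorting the elements of Q by the values of f, with ties broken by an
    injective labeling, splits the order-preserving maps f : Q -> C_k according
    to the linear extensions s of Q; a linear extension whose labels have a
    ascents contributes binomial(k + a, d). A natural labeling gives Omega(Q, k),
    and the reversed labeling gives the number of strict order-preserving maps.
    Reversal exchanges ascents and descents, hence the strict count is
    (-1)^d Omega(Q, -k). When Q is graded of rank r, adding the rank function
    identifies maps to C_k with strict maps to C_(k+r), so that the polynomial
    p(m) = Omega(Q, m(r+2)+1) satisfies p(-1-m) = (-1)^d p(m) = -p(m). The
    (d+2)-nd finite difference of p vanishes, and this symmetry folds it into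
    twice the sum in question. *)

Require Import Defs.
From mathcomp Require Import all_boot all_order all_algebra.
From mathcomp Require Import zify ring.

Import Order.TTheory GRing.Theory Num.Theory.
Local Open Scope ring_scope.

(** * Counting words with prescribed ascents *)

Lemma card_tuple_cons (T : finType) (n : nat) (P : pred (seq T)) :
  #|[set t : n.+1.-tuple T | P t]|
    = (\sum_(u : T) #|[set t : n.-tuple T | P (u :: t)]|)%N.
Proof.
rewrite -sum1_card (eq_bigl (fun t : n.+1.-tuple T => P t)); last first.
  by move=> t; rewrite inE.
rewrite (reindex (fun p : T * n.-tuple T => cons_tuple p.1 p.2)) /=; last first.
  exists (fun t => (thead t, behead_tuple t)) => [[u t] _|t _] /=.
    by congr pair; apply: val_inj.
  by rewrite [in RHS](tuple_eta t); apply: val_inj.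
rewrite -(pair_big_dep xpredT (fun u (t : n.-tuple T) => P (u :: t))
  (fun _ _ => 1%N)) /=.
by apply: eq_bigr => u _; rewrite -sum1_card; apply: eq_bigl => t; rewrite inE.
Qed.

Definition lexlt (p q : nat * nat) : bool :=
  ((p.1 < q.1) || (p.1 == q.1) && (p.2 < q.2))%N.

(** The number of ascents of the word [c :: l]; the head is a separate argument, as in [path]. *)
Fixpoint ascents (c : nat) (l : seq nat) : nat :=
  if l is c' :: l' then ((c < c') + ascents c' l')%N else 0%N.

Lemma ascents_size c l : (ascents c l <= size l)%N.
Proof.
elim: l c => //= c' l IH c; have := IH c'; case: (c < c')%N; lia.
Qed.

(** Hockey-stick identity; [a <= n] makes the missing initial term ['C(a, n.+1)] vanish. *)
Lemma sum_bin_shift (a n m : nat) :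
  (a <= n)%N -> (\sum_(i < m) 'C(i + a, n))%N = 'C(m + a, n.+1).
Proof.
move=> le_an; elim: m => [|m IH]; first by rewrite big_ord0 bin_small.
by rewrite big_ord_recr /= IH addSn binS addnC.
Qed.

Lemma sum_bin_from (a n k m : nat) : (a <= n)%N -> (m <= k)%N ->
  (\sum_(u < k | (m <= u)%N) 'C(k.-1 - u + a, n))%N = 'C(k - m + a, n.+1).
Proof.
move=> le_an le_mk; rewrite -(@sum_bin_shift a n (k - m)) //.
rewrite -(big_mkord (fun u => m <= u)%N (fun u => 'C(k.-1 - u + a, n))).
rewrite -(big_mkord xpredT (fun i => 'C(i + a, n))).
rewrite (@big_cat_nat _ _ _ m) //= big_nat_cond big_pred0 ?add0n; last first.
  by move=> i; lia.
rewrite -{1}[m]add0n big_addn big_mkcond /= big_nat_rev /=.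
rewrite !big_mkord; apply: eq_bigr => i _.
have lt_i := ltn_ord i.
rewrite leq_addl; congr 'C(_, _); lia.
Qed.

(** After the value [v], the next value may equal [v] at an ascent of the labels and must exceed it
    otherwise, so each ascent adds one to the upper index. *)
Lemma card_lex_paths (k v c : nat) (l : seq nat) : (v < k)%N ->
  #|[set t : (size l).-tuple 'I_k | path lexlt (v, c) (zip (map val t) l)]|
    = 'C(k.-1 - v + ascents c l, size l).
Proof.
elim: l v c => [|c' l IH] v c lt_vk /=.
  rewrite bin0; apply/eqP/cards1P; exists [tuple].
  by apply/setP=> t; rewrite !inE tuple0 eqxx.
rewrite (@card_tuple_cons _ _ (fun t : seq 'I_k => path lexlt (v, c) (zip (map val t) (c' :: l)))).
have step (u : 'I_k) : #|[set t : (size l).-tuple 'I_k |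
    path lexlt (v, c) (zip (map val (u :: t)) (c' :: l))]|
  = (if lexlt (v, c) (nat_of_ord u, c') then 'C(k.-1 - u + ascents c' l, size l) else 0)%N.
  case: ifP => lexuv; last first.
    by apply/eqP; rewrite cards_eq0; apply/eqP/setP=> t; rewrite !inE /= lexuv.
  by rewrite -(IH u c') //; apply: eq_card => t; rewrite !inE /= lexuv.
rewrite (eq_bigr _ (fun u _ => step u)) -big_mkcond /=.
have asz := ascents_size c' l.
rewrite (eq_bigl (fun u : 'I_k => v + (c' <= c) <= u)%N); last first.
  by move=> u; rewrite /lexlt /=; case: leqP; lia.
rewrite sum_bin_from //; last by case: leqP; lia.
by congr 'C(_, _); case: leqP; lia.
Qed.

Lemma card_lex_sorted (k c : nat) (l : seq nat) :
  #|[set t : (size (c :: l)).-tuple 'I_k | sorted lexlt (zip (map val t) (c :: l))]|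
    = 'C(k + ascents c l, (size l).+1).
Proof.
rewrite (@card_tuple_cons _ _ (fun t : seq 'I_k => sorted lexlt (zip (map val t) (c :: l)))) /=.
rewrite (eq_bigr (fun u : 'I_k => 'C(k.-1 - u + ascents c l, size l))); last first.
  by move=> u _; rewrite -card_lex_paths.
have := @sum_bin_from (ascents c l) (size l) k 0 (ascents_size c l) (leq0n k).
by rewrite subn0 => <-.
Qed.

(** Distinct labels leave no ties, so each consecutive pair is an ascent for exactly one of the two
    opposite labelings. *)
Lemma ascents_reverse_label (T : eqType) (w : T -> nat) (n : nat) (x : T) (s : seq T) :
  injective w -> (forall y, w y <= n)%N -> uniq (x :: s) ->
  (ascents (n - w x) [seq n - w y | y <- s] + ascents (w x) (map w s) = size s)%N.
Proof.
move=> winj wn; elim: s x => //= y s IH x.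
rewrite inE negb_or -andbA => /and4P[nxy _ ys us].
have := IH y; rewrite /= ys us => /(_ isT) <-.
have := wn x; have := wn y.
have : w x != w y by rewrite (inj_eq winj).
lia.
Qed.

(** * Sorting by values and labels *)

Section LinearExtensions.
Variables (disp : Order.disp_t) (Q : finPOrderType disp).
Implicit Types (w : Q -> nat) (s : seq Q).

(** Only forbids a later element below an earlier one; that [s] lists [Q] is imposed separately by
    [perm_eq s (enum Q)]. *)
Definition linear_extension s : bool := pairwise (fun x y => ~~ (y < x)%O) s.

Definition lex_by w {k : nat} (f : {ffun Q -> 'I_k}) : rel Q :=
  fun x y => lexlt (nat_of_ord (f x), w x) (nat_of_ord (f y), w y).

Definition ascents_of w s : nat :=
  if s is x :: s' then ascents (w x) (map w s') else 0%N.

Lemma card_lex_by_sorted w k s : perm_eq s (enum Q) -> (0 < #|Q|)%N ->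
  #|[set f : {ffun Q -> 'I_k} | sorted (lex_by w f) s]|
    = 'C(k + ascents_of w s, #|Q|).
Proof.
move=> sP Q0; have ss : size s = #|Q| by rewrite (perm_size sP) -cardE.
have sall x : x \in s by rewrite (perm_mem sP) mem_enum.
case: s ss sP sall => [|x s] ss sP sall; first by rewrite -ss in Q0.
have ssz : size (map w (x :: s)) == size (x :: s) by rewrite size_map.
pose h (f : {ffun Q -> 'I_k}) : (size (map w (x :: s))).-tuple 'I_k :=
  tcast (esym (eqP ssz)) (map_tuple f (in_tuple (x :: s))).
have hE f : h f = map f (x :: s) :> seq _ by rewrite val_tcast.
have hinj : injective h.
  move=> f g /(congr1 val); rewrite /= !hE => /eq_in_map fg.
  by apply/ffunP=> y; apply: fg.
have hbij : bijective h.
  by apply: inj_card_bij => //; rewrite card_ffun card_tuple size_map ss.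
have := card_lex_sorted k (w x) (map w s).
rewrite size_map /= in ss *; rewrite ss => <-.
rewrite -(on_card_preimset (onW_bij _ hbij)); apply: eq_card => f; rewrite !inE hE.
transitivity (sorted lexlt (map (fun y => (nat_of_ord (f y), w y)) (x :: s))).
  by rewrite sorted_map.
by congr (sorted lexlt _); rewrite /=; congr cons; elim: (s) => //= y t ->.
Qed.

Lemma lex_by_trans {w : Q -> nat} {k} {f : {ffun Q -> 'I_k}} : transitive (lex_by w f).
Proof. by move=> y x z; rewrite /lex_by /lexlt /=; lia. Qed.

Lemma lex_by_irr w k (f : {ffun Q -> 'I_k}) : irreflexive (lex_by w f).
Proof. by move=> x; rewrite /lex_by /lexlt /=; lia. Qed.

(** Injective labels break all ties, so [lex_by w f] is a strict total order and sorts [Q] in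
    exactly one way. *)
Lemma count_lex_by_sorted w k (f : {ffun Q -> 'I_k}) : injective w ->
  (\sum_(s <- permutations (enum Q)) sorted (lex_by w f) s = 1)%N.
Proof.
move=> winj.
pose e x y := (x == y) || lex_by w f x y.
have etot : total e.
  move=> x y; rewrite /e /lex_by /lexlt /=.
  case: (eqVneq x y) => //= nxy; have : w x != w y by rewrite (inj_eq winj).
  by rewrite ?[y == x]eq_sym ?(negbTE nxy) /=; lia.
have etr : transitive e.
  move=> y x z; rewrite /e; case/predU1P=> [->//|xy]; case/predU1P=> [<-|yz].
    by rewrite xy orbT.
  by rewrite (lex_by_trans _ _ _ xy yz) orbT.
pose s0 := sort e (enum Q).
have s0P : perm_eq s0 (enum Q) by rewrite perm_sort.
have s0s : sorted (lex_by w f) s0.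
  have : uniq s0 by rewrite (perm_uniq s0P) enum_uniq.
  rewrite sorted_pairwise; last exact: lex_by_trans.
  have := sort_sorted etot (enum Q); rewrite -/s0 sorted_pairwise //.
  elim: (s0) => //= x t IH /andP[xt et] /andP[nx ut]; rewrite IH // andbT.
  apply/allP=> y yt; have /allP/(_ _ yt)/predU1P[xy|//] := xt.
  by rewrite xy yt in nx.
rewrite (bigD1_seq s0) ?permutations_uniq ?mem_permutations //= s0s big1_seq //.
move=> s /andP[ns]; rewrite mem_permutations => sP.
apply/eqP; rewrite eqb0; apply: contra ns => ssorted; apply/eqP.
apply: (irr_sorted_eq (@lex_by_trans w k f) (lex_by_irr w k f)) => //.
by apply: perm_mem; rewrite (perm_trans sP) // perm_sym.
Qed.

(** Double counting: each [f] is charged to its unique sorted listing, which alone decides [C f]. *)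
Lemma card_by_linear_extensions w k (C : pred {ffun Q -> 'I_k}) :
  injective w -> (0 < #|Q|)%N ->
  (forall f s, perm_eq s (enum Q) -> sorted (lex_by w f) s ->
     C f = linear_extension s) ->
  #|[set f | C f]| = (\sum_(s <- permutations (enum Q) | linear_extension s)
    'C(k + ascents_of w s, #|Q|))%N.
Proof.
move=> winj Q0 CP; rewrite -sum1_card.
rewrite (eq_bigr (fun f => \sum_(s <- permutations (enum Q)) sorted (lex_by w f) s)%N);
  last by move=> f _; rewrite count_lex_by_sorted.
rewrite exchange_big /= [RHS]big_mkcond /=.
apply: eq_big_seq => s; rewrite mem_permutations => sP.
rewrite -(card_lex_by_sorted w) // -sum1_card.
case: ifP => ls.
  rewrite big_mkcond [RHS]big_mkcond; apply: eq_bigr => f _; rewrite !inE.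
  case: (boolP (sorted _ _)) => fs; last by case: ifP.
  by rewrite (CP f s) // ls.
apply: big1 => f; rewrite inE => Cf; apply/eqP; rewrite eqb0.
by apply: contraFN ls => fs; rewrite -(CP f s).
Qed.

(** * Strict maps and natural labelings *)

Definition strict_order_preserving {k} (f : {ffun Q -> 'I_k}) : bool :=
  [forall x, forall y, (x < y)%O ==> (f x < f y)%N].

Definition strict_order_polynomial k : nat :=
  #|[set f : {ffun Q -> 'I_k} | strict_order_preserving f]|.

(** Labels are positions after sorting by the number of elements strictly below, which grows
    strictly along [<]. *)
Lemma natural_labeling : exists w : Q -> nat,
  [/\ injective w, forall x y, (x < y)%O -> (w x < w y)%N & forall x, (w x < #|Q|)%N].
Proof.
pose ht (x : Q) := #|[set z | (z < x)%O]|.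
pose e := relpre ht leq.
pose s := sort e (enum Q).
have sall x : x \in s by rewrite mem_sort mem_enum.
have ssz : size s = #|Q| by rewrite size_sort -cardE.
have ss : sorted e s by apply: sort_sorted => x y; apply: leq_total.
exists (fun x => index x s); split=> [x y|x y xy|x].
- by move/(congr1 (nth x s)); rewrite !nth_index.
- rewrite ltnNge; apply/negP => yx.
  have : e y x.
    apply: (sorted_leq_index _ _ ss) => //; rewrite /e.
    - by move=> a b c /=; apply: leq_trans.
    - by move=> a /=; apply: leqnn.
  rewrite /e /= leqNgt; apply/negP; rewrite negbK; apply: proper_card.
  apply/properP; split.
    by apply/subsetP=> z; rewrite !inE => /lt_trans; apply.
  by exists x; rewrite inE ?ltxx.
- by rewrite -ssz index_mem.
Qed.

Lemma pairwise_related (e : rel Q) s x y :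
  pairwise e s -> x \in s -> y \in s -> x != y -> e x y || e y x.
Proof.
elim: s => //= z s IH /andP[zs ps]; rewrite !inE.
case/predU1P=> [->|xs]; case/predU1P=> [->|ys]; rewrite ?eqxx //.
- by move/allP: zs => /(_ _ ys) ->.
- by move/allP: zs => /(_ _ xs) ->; rewrite orbT.
- exact: IH.
Qed.

(** Turns a condition on [s] into one on [f]: [s] is increasing for the total order [lex_by w f], so
    it respects [<] exactly when that order extends [<]. *)
Lemma linear_extension_lex_by w k (f : {ffun Q -> 'I_k}) s :
  perm_eq s (enum Q) -> sorted (lex_by w f) s ->
  linear_extension s = [forall x, forall y, (x < y)%O ==> lex_by w f x y].
Proof.
move=> sP; rewrite sorted_pairwise; last exact: lex_by_trans.
have sall x : x \in s by rewrite (perm_mem sP) mem_enum.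
move=> ps; apply/idP/idP => [ls|/forallP H].
  apply/forallP=> x; apply/forallP=> y; apply/implyP=> xy.
  have := conj ls ps => /andP; rewrite /linear_extension -pairwise_relI.
  move/pairwise_related => /(_ _ _ (sall x) (sall y)).
  by rewrite (lt_eqF xy) => /(_ isT) /orP[] /= /andP[]; rewrite ?xy.
apply: sub_pairwise ps => x y xy; apply/negP=> yx.
have /forallP/(_ x)/implyP/(_ yx) yx' := H y.
by have := lex_by_irr w k f x; rewrite (lex_by_trans _ _ _ xy yx').
Qed.

End LinearExtensions.

(** * Finite differences *)

(** Pascal's rule: a difference of order [n.+1] is one of order [n] applied to the first
    difference. *)
Lemma sum_by_parts_bin (n : nat) (g : nat -> int) :
  \sum_(j < n.+2) (-1) ^+ j * ('C(n.+1, j))%:Z * g j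
    = \sum_(j < n.+1) (-1) ^+ j * ('C(n, j))%:Z * (g j - g j.+1).
Proof.
rewrite big_ord_recl /= bin0 expr0.
under eq_bigr => j _ do rewrite /bump /= add1n binS exprS PoszD !mulrDr mulrDl.
rewrite big_split /= addrA.
under [RHS]eq_bigr => j _ do rewrite mulrBr.
rewrite sumrB; congr (_ + _).
  rewrite [RHS]big_ord_recl /= bin0 expr0; congr (_ + _).
  rewrite big_ord_recr /= bin_small // mulr0 mul0r addr0.
  by apply: eq_bigr => j _; rewrite /bump /= add1n exprS.
rewrite -sumrN; apply: eq_bigr => j _; ring.
Qed.

(** A finite difference of order above the degree vanishes; induction on the number of linear
    factors. *)
Lemma alternating_sum_linear_prod (a : int) (d : nat) (b : nat -> int) (x : int) (n : nat) :
  (d < n)%N ->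
  \sum_(j < n.+1) (-1) ^+ j * ('C(n, j))%:Z * \prod_(i < d) (a * (x - j%:Z) + b i) = 0.
Proof.
elim: d n x => [|d IH] [//|n] x lt_dn.
  rewrite (sum_by_parts_bin n (fun j => \prod_(i < 0) (a * (x - j%:Z) + b i))) big1 // => j _.
  by rewrite !big_ord0 subrr mulr0.
have IH' y : \sum_(j < n.+1) (-1) ^+ j * ('C(n, j))%:Z
    * \prod_(i < d) (a * (y - j%:Z) + b i) = 0 by apply: IH.
have IH1 : \sum_(j < n.+2) (-1) ^+ j * ('C(n.+1, j))%:Z
    * \prod_(i < d) (a * (x - j%:Z) + b i) = 0 by apply: IH; lia.
under eq_bigr => j _ do rewrite big_ord_recr /=.
(* The last factor is [(a * x + b d) - a * j]; absorbing [j] by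
   [j.+1 * 'C(n.+1, j.+1) = n.+1 * 'C(n, j)] lowers the order and shifts [x] by one. *)
transitivity ((a * x + b d) * (\sum_(j < n.+2) (-1) ^+ j * ('C(n.+1, j))%:Z
    * \prod_(i < d) (a * (x - j%:Z) + b i))
  + (a * n.+1%:Z) * \sum_(j < n.+1) (-1) ^+ j * ('C(n, j))%:Z
    * \prod_(i < d) (a * (x - 1 - j%:Z) + b i)); last first.
  by rewrite IH1 IH' !mulr0 addr0.
transitivity (\sum_(j < n.+2) ((a * x + b d) * ((-1) ^+ j * ('C(n.+1, j))%:Z
    * \prod_(i < d) (a * (x - j%:Z) + b i)) - a * ((-1) ^+ j * (j * 'C(n.+1, j))%:Z *
     \prod_(i < d) (a * (x - j%:Z) + b i)))).
  by apply: eq_bigr => j _; rewrite PoszM; ring.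
rewrite sumrB -!mulr_sumr; congr (_ + _).
rewrite big_ord_recl /= mul0n mulr0 mul0r add0r -mulrA -mulrN; congr (a * _).
rewrite mulr_sumr -sumrN; apply: eq_bigr => j _.
rewrite /bump /= add1n exprS -mul_bin_diag PoszM.
have xj : x - j.+1%:Z = x - 1 - j%:Z by rewrite -addn1 PoszD; ring.
under eq_bigr => i _ do rewrite xj.
ring.
Qed.

Lemma ffactZ (n m : nat) : (n ^_ m)%:Z = \prod_(i < m) (n%:Z - i%:Z).
Proof.
elim: m => [|m IH]; first by rewrite big_ord0 ffactn0.
rewrite ffactnSr big_ord_recr /= -IH PoszM.
have [le_mn|lt_nm] := leqP m n; first by rewrite subzn.
by rewrite ffact_small // !mul0r.
Qed.

(* With a ascents and b descents, this is binomial reciprocity, multiplied by d!. *)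
Lemma ffact_reciprocity (k a b d : nat) : (a + b = d.-1)%N ->
  (\prod_(i < d) (- k%:Z + a%:Z - i%:Z) = (-1) ^+ d * ((k + b) ^_ d)%:Z).
Proof.
move=> abd; rewrite ffactZ (reindex_inj rev_ord_inj) /=.
rewrite -[d in (-1) ^+ d]card_ord -prodr_const -big_split /=.
apply: eq_bigr => i _; have := ltn_ord i; lia.
Qed.

(* The involution j |-> 2M + 1 - j exchanges the two halves of the full
   alternating sum, which is therefore twice the half sum. *)
Lemma half_alternating_sum (M : nat) (p : int -> int) :
  (forall m, p (- 1 - m) = - p m) ->
  \sum_(j < (M.*2).+2) (-1) ^+ j * ('C((M.*2).+1, j))%:Z * p (M%:Z - j%:Z) = 0 ->
  \sum_(0 <= m < M.+1) (-1) ^+ (M + m) * ('C((M.*2).+1, M - m))%:Z * p m%:Z = 0.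
Proof.
move=> pneg; rewrite -(big_mkord xpredT (fun j =>
  (-1) ^+ j * ('C((M.*2).+1, j))%:Z * p (M%:Z - j%:Z))).
set S := (X in _ -> X = 0).
rewrite (@big_cat_nat _ _ _ M.+1) //=; last by lia.
have -> : \sum_(0 <= i < M.+1) (-1) ^+ i * ('C((M.*2).+1, i))%:Z * p (M%:Z - i%:Z) = S.
  rewrite /S [RHS]big_nat_rev /= !big_mkord; apply: eq_bigr => i _.
  have := ltn_ord i; rewrite ltnS => le_i.
  rewrite add0n subSS subKn // subzn // -signr_odd -[in RHS]signr_odd.
  by congr (_ ^+ (nat_of_bool _) * _ * _); lia.
(* With [j = i + M.+1], the sign in [p (-1 - i) = - p i] compensates the extra sign of the shift,
   and the binomial is symmetric. *)
have -> : \sum_(M.+1 <= i < (M.*2).+2) (-1) ^+ i * ('C((M.*2).+1, i))%:Z * p (M%:Z - i%:Z) = S.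
  rewrite -{1}[M.+1]add0n big_addn (_ : (M.*2).+2 - M.+1 = M.+1)%N; last by lia.
  rewrite /S !big_mkord; apply: eq_bigr => i _.
  have := ltn_ord i; rewrite ltnS => le_i.
  rewrite -bin_sub; last by lia.
  rewrite (_ : M%:Z - (i + M.+1)%:Z = -1 - i%:Z); last by lia.
  rewrite pneg (_ : (M.*2).+1 - (i + M.+1) = M - i)%N; last by lia.
  by rewrite addnS exprS addnC; ring.
lia.
Qed.

(** * Maximal chains *)

Section Graded.
Variables (disp : Order.disp_t) (Q : finPOrderType disp).
Implicit Types (A B : {set Q}) (x y z : Q).
Local Open Scope order_scope.

Lemma is_chainP A :
  reflect {in A &, forall x y, x >=< y} (is_chain A).
Proof.
apply: (iffP forall_inP) => [H x y xA yA|H x xA].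
  by have /forall_inP := H x xA; apply.
by apply/forall_inP => y yA; apply: H.
Qed.

Lemma maxchainP A :
  reflect (is_chain A /\ forall z, {in A, forall x, x >=< z} -> z \in A)
          (maxset (@is_chain disp Q) A).
Proof.
apply: (iffP maxsetP) => -[cA maxA]; split=> //; last first.
  move=> B cB AB.
  apply/eqP; rewrite eqEsubset AB andbT; apply/subsetP=> z zB; apply: maxA => x xA.
  by move/is_chainP: cB; apply=> //; apply: (subsetP AB).
move=> z zA; have <- : z |: A = A; last by rewrite !inE eqxx.
apply: maxA; last exact: subsetUr.
apply/is_chainP => x y; rewrite !inE.
  case/predU1P=> [->|xA]; case/predU1P=> [->|yA]; first exact: comparablexx.
  - by rewrite comparable_sym zA.
  - exact: zA.
  - by move/is_chainP: cA; apply.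
Qed.

Lemma maxchain_through x y : x <= y ->
  exists A, [/\ maxset (@is_chain disp Q) A, x \in A & y \in A].
Proof.
move=> xy; have : is_chain [set x; y].
  apply/is_chainP=> a b; rewrite !inE => /orP[]/eqP-> /orP[]/eqP->;
    by rewrite /Order.comparable ?lexx ?xy ?orbT.
move=> /maxset_exists[A mA sA]; exists A.
by split=> //; apply: (subsetP sA); rewrite !inE eqxx ?orbT.
Qed.

(** Maximality: a [z] comparable to the new set is comparable to [x]. If [z < x], it lies below the
    rest of [A], hence in [A]; otherwise it lies above the discarded part of [B], hence in [B]. *)
Lemma maxchain_swap A B x : maxset (@is_chain disp Q) A ->
  maxset (@is_chain disp Q) B -> x \in A -> x \in B ->
  maxset (@is_chain disp Q) ([set a in A | a < x] :|: [set a in B | x <= a]).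
Proof.
move=> /maxchainP[/is_chainP cA mA] /maxchainP[/is_chainP cB mB] xA xB.
apply/maxchainP; split.
  apply/is_chainP=> a b; rewrite !inE.
  case/orP=> /andP[aA ax]; case/orP=> /andP[bA bx].
  - exact: cA.
  - by rewrite /Order.comparable (le_trans (ltW ax) bx).
  - by rewrite /Order.comparable (le_trans (ltW bx) ax) orbT.
  - exact: cB.
move=> z zc; have := zc x; rewrite !inE xB lexx orbT => /(_ isT).
rewrite /Order.comparable => xz.
have [zx|nzx] := boolP (z < x).
  rewrite andbT mA // => a aA; have := cA a x aA xA; rewrite /Order.comparable.
  case/orP; last by move=> xa; rewrite (le_trans (ltW zx) xa) orbT.
  rewrite le_eqVlt => /predU1P[->|ax]; first by rewrite (ltW zx) orbT.
  by apply: zc; rewrite !inE aA ax.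
have {}xz : x <= z by case/orP: xz => //; rewrite le_eqVlt (negbTE nzx) orbF => /eqP->.
rewrite xz andbT mB ?orbT // => a aB; have := cB a x aB xB; rewrite /Order.comparable.
case/orP; first by move=> ax; rewrite (le_trans ax xz).
by move=> xa; apply: zc; rewrite !inE aB xa orbT.
Qed.

Lemma card_chain_split A x : is_chain A -> x \in A ->
  #|A| = (#|[set a in A | (a < x)%O]| + #|[set a in A | (x <= a)%O]|)%N.
Proof.
move=> /is_chainP cA xA; have I0 : [set a in A | a < x] :&: [set a in A | x <= a] = set0.
  by apply/setP=> a; rewrite !inE; case: comparableP; rewrite ?andbF.
rewrite -cardsUI I0 cards0 addn0; apply: eq_card => a; rewrite !inE.
case: (boolP (a \in A)) => //= aA; have := cA a x aA xA.
by case: comparableP.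
Qed.

(** A strict map is injective on a chain, which thus embeds in the integers from [u] to [v], [v]
    excluded. *)
Lemma strict_increment k (f : {ffun Q -> 'I_k}) A (u v : nat) :
  (forall x y, (x < y)%O -> (f x < f y)%N) ->
  is_chain A -> (forall a, a \in A -> u <= f a < v)%N -> (#|A| <= v - u)%N.
Proof.
move=> fP /is_chainP cA fA.
have inj : {in A &, injective f}.
  move=> a b aA bA; have := cA a b aA bA; rewrite /Order.comparable.
  case: comparableP => // ab _ fab; by have := fP _ _ ab; rewrite fab ltnn.
pose t := [seq nat_of_ord (f a) | a <- enum A].
have -> : #|A| = size t by rewrite size_map -cardE.
rewrite -(size_iota u (v - u)); apply: uniq_leq_size.
  rewrite map_inj_in_uniq ?enum_uniq // => a b; rewrite !mem_enum => aA bA /val_inj.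
  exact: inj.
move=> n /mapP[a]; rewrite mem_enum => aA ->.
by rewrite mem_iota; have := fA a aA; lia.
Qed.

Lemma sub_is_chain A B : A \subset B -> is_chain B -> is_chain A.
Proof.
move=> /subsetP AB /is_chainP cB; apply/is_chainP=> x y /AB xB /AB yB.
exact: cB.
Qed.

End Graded.

(** * Reciprocity and the graded case *)

Section OrderPolynomial.
Variables (disp : Order.disp_t) (Q : finPOrderType disp).

(** Ties of [f] are broken in favour of the smaller element, so respecting [<] only requires weak
    inequalities. *)
Lemma order_polynomial_natural (w : Q -> nat) k : injective w ->
  (forall x y, (x < y)%O -> (w x < w y)%N) -> (0 < #|Q|)%N ->
  order_polynomial Q k = (\sum_(s <- permutations (enum Q) | linear_extension _ _ s)
    'C(k + ascents_of _ _ w s, #|Q|))%N.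
Proof.
move=> winj wmono Q0; apply: card_by_linear_extensions => // f s sP fs.
rewrite (linear_extension_lex_by _ _ w k f) //.
apply: eq_forallb => x; apply: eq_forallb => y.
rewrite /lex_by /lexlt /= le_eqVlt; case: eqVneq => [->|_] /=.
  by rewrite leEord leqnn ltxx.
case: (boolP (x < y)%O) => //= /wmono ->; rewrite andbT leEord leq_eqVlt.
by rewrite orbC.
Qed.

(** Labels now decrease along [<], so a tie would put the larger element first and is forbidden. *)
Lemma strict_order_polynomial_antinatural (w : Q -> nat) k : injective w ->
  (forall x y, (x < y)%O -> (w y < w x)%N) -> (0 < #|Q|)%N ->
  strict_order_polynomial _ Q k =
    (\sum_(s <- permutations (enum Q) | linear_extension _ _ s)
      'C(k + ascents_of _ _ w s, #|Q|))%N.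
Proof.
move=> winj wmono Q0; apply: card_by_linear_extensions => // f s sP fs.
rewrite (linear_extension_lex_by _ _ w k f) //.
apply: eq_forallb => x; apply: eq_forallb => y.
rewrite /lex_by /lexlt /=; case: (boolP (x < y)%O) => //= /wmono wxy.
by rewrite [(w x < w y)%N]ltnNge (ltnW wxy) andbF orbF.
Qed.

(** The factorial clears denominators. The list [t] holds the ascent numbers of the linear
    extensions for one natural labeling and serves both counts: the second is the first at [- k], up
    to sign. *)
Lemma order_polynomial_reciprocity : (0 < #|Q|)%N ->
  exists (t : seq nat),
    (forall k, (#|Q|`! * order_polynomial Q k)%:Z
       = \sum_(a <- t) \prod_(i < #|Q|) (k%:Z + a%:Z - i%:Z)) /\
    (forall k, (#|Q|`! * strict_order_polynomial _ Q k)%:Z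
       = (-1) ^+ #|Q| * \sum_(a <- t) \prod_(i < #|Q|) (- k%:Z + a%:Z - i%:Z)).
Proof.
move=> Q0; have [w [winj wmono wlt]] := natural_labeling _ Q.
exists [seq ascents_of _ _ w s | s <- permutations (enum Q) & linear_extension _ _ s].
split=> k.
  rewrite (order_polynomial_natural w) // big_distrr /= raddf_sum big_map big_filter.
  apply: eq_bigr => s _; rewrite -[LHS]/(Posz _) mulnC bin_ffact ffactZ.
  by apply: eq_bigr => i _; rewrite PoszD.
pose w' x := (#|Q| - w x)%N.
have w'inj : injective w'.
  by move=> x y; rewrite /w' => e; apply: winj; have := wlt x; have := wlt y; lia.
rewrite (strict_order_polynomial_antinatural w') //; last first.
  by move=> x y /wmono; rewrite /w'; have := wlt y; lia.
rewrite big_distrr /= raddf_sum big_map big_filter mulr_sumr.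
rewrite big_seq_cond [RHS]big_seq_cond; apply: eq_bigr => s.
rewrite mem_permutations => /andP[sP _].
rewrite -[LHS]/(Posz _) mulnC bin_ffact.
rewrite (ffact_reciprocity k _ (ascents_of _ _ w' s)).
  by rewrite mulrA -exprMn mulrNN mulr1 expr1n mul1r.
have ss : size s = #|Q| by rewrite (perm_size sP) -cardE.
have us : uniq s by rewrite (perm_uniq sP) enum_uniq.
case: s ss us {sP} => [|x s] ss us; first by rewrite -ss in Q0.
rewrite addnC -ss /=; apply: ascents_reverse_label => // y.
exact: ltnW.
Qed.

(* Exchanging the parts of two maximal chains below a common element x gives
   another maximal chain, so all maximal chains have the same size below x. *)
Lemma graded_rank_function (r : nat) : graded_of_rank Q r ->
  exists rk : Q -> nat, forall (A : {set Q}) x, maxset (@is_chain disp Q) A -> x \in A ->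
    #|[set a in A | (a < x)%O]| = rk x.
Proof.
move=> Qr.
exists (fun x => if [pick A : {set Q} | maxset (@is_chain disp Q) A && (x \in A)]
  is Some A then #|[set a in A | (a < x)%O]| else 0%N) => A x mA xA.
case: pickP => [B /andP[mB xB]|/(_ A)]; last by rewrite mA xA.
have mS := maxchain_swap _ _ A B x mA mB xA xB.
have xS : x \in [set a in A | (a < x)%O] :|: [set a in B | (x <= a)%O].
  by rewrite !inE xB lexx orbT.
have eS := card_chain_split _ _ _ x (proj1 (elimT (maxchainP _ _ _) mS)) xS.
have eB := card_chain_split _ _ _ x (proj1 (elimT (maxchainP _ _ _) mB)) xB.
have low : [set a in [set a in A | (a < x)%O] :|: [set a in B | (x <= a)%O] | (a < x)%O]
    = [set a in A | (a < x)%O].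
  by apply/setP=> a; rewrite !inE; case: comparableP; rewrite ?andbF ?andbT ?orbF.
have high : [set a in [set a in A | (a < x)%O] :|: [set a in B | (x <= a)%O] | (x <= a)%O]
    = [set a in B | (x <= a)%O].
  by apply/setP=> a; rewrite !inE; case: comparableP; rewrite ?andbF ?andbT.
rewrite low high (Qr _ mS) in eS; rewrite (Qr _ mB) in eB.
exact: addIn (etrans (esym eS) eB).
Qed.

Lemma strict_order_polynomial_graded (r k : nat) : graded_of_rank Q r ->
  strict_order_polynomial _ Q (k + r) = order_polynomial Q k.
Proof.
move=> Qr; have [rk rkE] := graded_rank_function r Qr.
have rk_top A x : maxset (@is_chain disp Q) A -> x \in A ->
    (rk x + #|[set a in A | (x <= a)%O]| = r.+1)%N.
  move=> mA xA; rewrite -(rkE A) // -(Qr _ mA).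
  by rewrite -card_chain_split //; case/maxchainP: mA.
have rk_le x : (rk x <= r)%N.
  have [A [mA xA _]] := maxchain_through _ _ _ _ (lexx x).
  have := rk_top A x mA xA.
  rewrite (cardD1 x) !inE xA lexx; lia.
have rk_between A x y : maxset (@is_chain disp Q) A -> x \in A -> y \in A ->
    (x <= y)%O -> (rk x + #|[set a in A | (x <= a < y)%O]| = rk y)%N.
  move=> mA xA yA xy; rewrite -(rkE A x) // -(rkE A y) //.
  rewrite -[RHS](cardsID [set a | (a < x)%O]); congr (_ + _)%N; apply: eq_card => a.
    rewrite !inE; case: (a \in A) => //=; case: (boolP (a < x)%O) => [ax|_].
      by rewrite (lt_le_trans ax xy).
    by rewrite andbF.
  rewrite !inE; case: (boolP (a \in A)) => //= [aA|_]; last by rewrite andbF.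
  have /maxchainP[/is_chainP cA _] := mA.
  by have := cA a x aA xA; case: comparableP.
pose h (g : {ffun Q -> 'I_k}) : {ffun Q -> 'I_(k + r)} :=
  [ffun x => @Ordinal (k + r) (g x + rk x) (leq_add (ltn_ord (g x)) (rk_le x))].
have hinj : injective h.
  move=> g g' /ffunP gg; apply/ffunP=> x; apply: val_inj.
  by have := congr1 val (gg x); rewrite /h !ffunE /= => /addIn.
rewrite /order_polynomial -(card_imset _ hinj); apply: eq_card => f; rewrite !inE.
apply/idP/imsetP => [fP|[g]].
  have {}fP x y : (x < y)%O -> (f x < f y)%N.
    by move=> xy; have /forallP/(_ x)/forallP/(_ y)/implyP := fP; apply.
  have fle x y : (x <= y)%O -> (f x <= f y)%N.
    by rewrite le_eqVlt => /predU1P[->//|/fP/ltnW].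
  (* On a maximal chain, [f] is injective on the [rk y - rk x] elements from [x] up to [y] excluded;
     hence [f - rk] is weakly increasing. *)
  have incr x y : (x <= y)%O -> (rk y + f x <= rk x + f y)%N.
    move=> xy; have [A [mA xA yA]] := maxchain_through _ _ _ _ xy.
    have [cA _] := elimT (maxchainP _ _ _) mA.
    have := strict_increment _ _ _ f [set a in A | (x <= a < y)%O] (f x) (f y) fP.
    have := rk_between A x y mA xA yA xy.
    move: #|_| => c rkc H; have := fle x y xy.
    suff : (c <= f y - f x)%N by lia.
    apply: H.
      by apply: sub_is_chain cA; apply/subsetP=> a; rewrite inE => /andP[].
    by move=> a; rewrite inE => /and3P[_ /fle-> /fP->].
  (* The elements below [x] force [rk x <= f x]; the [r.+1 - rk x] elements from [x] upward must fit
     between [f x] and [k + r]. So [f - rk] takes values in ['I_k]. *)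
  have range x : (rk x <= f x < rk x + k)%N.
    have [A [mA xA _]] := maxchain_through _ _ _ _ (lexx x).
    have [cA _] := elimT (maxchainP _ _ _) mA.
    have rkx := rk_top A x mA xA.
    have := strict_increment _ _ _ f [set a in A | (a < x)%O] 0 (f x) fP.
    rewrite rkE // => H1.
    have := strict_increment _ _ _ f [set a in A | (x <= a)%O] (f x) (k + r) fP.
    move: #|_| rkx => c rkx H2; have := ltn_ord (f x).
    have {}H1 : (rk x <= f x - 0)%N.
      apply: H1; first by apply: sub_is_chain cA; apply/subsetP=> a; rewrite inE => /andP[].
      by move=> a; rewrite inE => /andP[_ /fP].
    have {}H2 : (c <= k + r - f x)%N.
      apply: H2; first by apply: sub_is_chain cA; apply/subsetP=> a; rewrite inE => /andP[].
      by move=> a; rewrite inE => /andP[_ /fle->] /=.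
    lia.
  have lt_k x : (f x - rk x < k)%N by have := range x; lia.
  exists [ffun x => Ordinal (lt_k x)].
    rewrite inE; apply/forallP=> x; apply/forallP=> y; apply/implyP=> xy.
    rewrite !ffunE leEord /=; have := incr x y xy.
    case/andP: (range x) => + _; case/andP: (range y) => + _.
    by move: (nat_of_ord (f x)) (nat_of_ord (f y)) => u v; lia.
  apply/ffunP=> x; apply: val_inj; case/andP: (range x) => le_rk _.
  by rewrite /h ffunE /= ffunE /= subnK.
rewrite inE => gP ->; apply/forallP=> x; apply/forallP=> y; apply/implyP=> xy.
have /forallP/(_ x)/forallP/(_ y) := gP; rewrite (ltW xy) leEord /h !ffunE /= => gxy.
have [A [mA xA yA]] := maxchain_through _ _ _ _ (ltW xy).
(* The count includes [x] itself, so [rk x < rk y] and adding [rk] makes [g] strict. *)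
have := rk_between A x y mA xA yA (ltW xy).
rewrite (cardD1 x) !inE xA lexx xy /=; lia.
Qed.

End OrderPolynomial.

(** * Antisymmetry and the vanishing sum *)

Theorem theorem5p12 (disp : Order.disp_t) (Q : finPOrderType disp) (d r : nat)
    (Qgraded : graded_of_rank Q r) (Qcard : #|Q| = d) (d_odd : odd d) :
  let N := uphalf d in (* the ceiling of d / 2 *)
  \sum_(0 <= m < N.+1)
     (-1) ^+ (N + m) * ('C(d + 2, N - m))%:Z
       * (order_polynomial Q (m * (r + 2) + 1))%:Z = 0 :> int.
Proof.
move=> N; have Q0 : (0 < #|Q|)%N by rewrite Qcard; case: (d) d_odd.
have [t [weakE strictE]] := order_polynomial_reciprocity _ _ Q0.
rewrite Qcard in weakE strictE.
(* [H] extends [d!] times the order polynomial to all integers, giving a meaning to negative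
   arguments. *)
pose H (x : int) : int := \sum_(a <- t) \prod_(i < d) (x + a%:Z - i%:Z).
pose p (x : int) := H (x * (r + 2)%:Z + 1).
have d2 : (d + 2 = N.*2.+1)%N by rewrite /N; lia.
(* Reciprocity combined with the rank shift; the minus sign comes from [d] being odd. *)
have Hneg k : H (- (k + r)%:Z) = - H k%:Z.
  have := strictE (k + r)%N; rewrite strict_order_polynomial_graded // weakE.
  by rewrite -signr_odd d_odd expr1 mulN1r -/(H _) -/(H _) => ->; rewrite opprK.
(* For [k = m * (r + 2) + 1] one has [-(k + r) = (-1 - m) * (r + 2) + 1], which explains the step
   [r + 2] and the offset 1. Negative [m] reduce to natural ones through the involution
   [m |-> -1 - m]. *)
have pneg m : p (- 1 - m) = - p m.
  have pneg_nat (n : nat) : p (- 1 - n%:Z) = - p n%:Z.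
    rewrite /p (_ : n%:Z * _ + 1 = (n * (r + 2) + 1)%N%:Z); last by lia.
    by rewrite -Hneg; congr H; lia.
  case: m => n; first exact: pneg_nat.
  rewrite NegzE (_ : - 1 - - n.+1%:Z = n%:Z); last by lia.
  by rewrite (_ : - n.+1%:Z = - 1 - n%:Z) ?pneg_nat ?opprK //; lia.
(* Each summand of [p] is a product of [d] linear factors, and the difference has order [d + 2]. *)
have diff : \sum_(j < (N.*2).+2) (-1) ^+ j * ('C((N.*2).+1, j))%:Z * p (N%:Z - j%:Z) = 0.
  rewrite /p /H; under eq_bigr => j _ do rewrite mulr_sumr.
  rewrite exchange_big big1 //= => a _.
  have lt_d : (d < N.*2.+1)%N by lia.
  rewrite -[RHS](alternating_sum_linear_prod (r + 2)%:Z d (fun i => 1 + a%:Z - i%:Z)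
    N%:Z _ lt_d).
  apply: eq_bigr => j _; congr (_ * _); apply: eq_bigr => i _; ring.
have d_fact : (d`!)%:Z != 0 :> int by rewrite eqz_nat -lt0n fact_gt0.
apply: (mulfI d_fact); rewrite mulr0 d2.
apply: etrans (half_alternating_sum N p pneg diff); rewrite big_distrr /=.
apply: eq_bigr => m _.
rewrite mulrCA -PoszM weakE -/(H _) /p; congr (_ * H _); lia.
Qed.
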